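(* Let $\lambda,\mu,R,C>0$. The optimal social welfare achievable by random routing is at most the optimal social welfare achievable by gated admission: $$\max_{p} u(\pi_p)\ \le\ \max_{\tau} u(\pi_\tau),$$ where $p$ ranges over all $p\in[0,1]$ with $\lambda p<\mu$, and $\tau$ ranges over all $\tau\in[0,\infty]$ with $\lambda_\tau<\mu$.
   Context: Potential customers arrive at a single-server queue in a Poisson process of rate $\lambda$; service times are i.i.d. exponential with rate $\mu$. Each served customer yields reward $R$, and each customer costs $C$ per unit time spent in the system. Random routing (RR) policy $\pi_p$: each arrival is admitted independently with probability $p$, which gives an M/M/1 queue with arrival rate $\lambda p$. For $\lambda p<\mu$ its stationary expected welfare per unit time is $$u(\pi_p)=\lambda p R-C\,\frac{\lambda p}{\mu-\lambda p}.$$ Gated admission (GA) policy $\pi_\tau$: after each admission, arrivals are blocked for $\tau$ time units, which gives a GI/M/1 queue with inter-arrival times distributed as $\tau+\mathrm{Exp}(\lambda)$ and effective arrival rate $\lambda_\tau=\frac{\lambda}{1+\lambda\tau}$. For $0\le\tau<\infty$ with $\lambda_\tau<\mu$, let $\sigma(\tau)\in(0,1)$ be the smallest positive solution of $\sigma=\frac{\lambda e^{-\mu(1-\sigma)\tau}}{\lambda+\mu(1-\sigma)}$. The stationary expected welfare per unit time is $$u(\pi_\tau)=\lambda_\tau R-C\,\frac{\lambda_\tau}{\mu(1-\sigma(\tau))}.$$ For $\tau=\infty$ (no admissions), $\lambda_\infty=0$ and $u(\pi_\infty)=0$. *)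

(* Defs.v *)
From Stdlib Require Import Reals ClassicalEpsilon.
From Coquelicot Require Import Coquelicot.

Open Scope R_scope.

(** Stdlib reals. Throughout, [lam] is the arrival rate, [mu] the service rate,
    [Rew] the reward per served customer and [C] the cost per customer and unit
    of time in the system. *)

Definition RR_admissible (lam mu p : R) : Prop :=
  0 <= p <= 1 /\ lam * p < mu.

Definition u_RR (lam mu Rew C p : R) : R :=
  lam * p * Rew - C * (lam * p / (mu - lam * p)).

(** The blocking time ranges over [0, +oo]; it is a [Rbar], and the value chosen
    for [m_infty] below is irrelevant since [GA_admissible] excludes it. *)

Definition lam_eff (lam : R) (tau : Rbar) : R :=
  match tau with
  | Finite t => lam / (1 + lam * t)
  | _ => 0
  end.

Definition GA_admissible (lam mu : R) (tau : Rbar) : Prop :=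
  Rbar_le 0 tau /\ lam_eff lam tau < mu.

(** The fixed-point equation of the GI/M/1 queue with inter-arrival times
    distributed as t + Exp(lam): its right-hand side is the Laplace transform
    of that distribution at mu (1 - s). *)
Definition sigma_equation (lam mu t s : R) : Prop :=
  s = lam * exp (- (mu * (1 - s) * t)) / (lam + mu * (1 - s)).

Definition is_sigma (lam mu t s : R) : Prop :=
  0 < s < 1 /\ sigma_equation lam mu t s /\
  (forall s', 0 < s' -> sigma_equation lam mu t s' -> s <= s').

(** At most one [s] satisfies [is_sigma], so [epsilon] returns it whenever it
    exists, which is the case for all 0 <= t with [lam_eff lam t < mu]. *)
Definition sigma (lam mu t : R) : R :=
  epsilon (inhabits 0) (is_sigma lam mu t).

Definition u_GA (lam mu Rew C : R) (tau : Rbar) : R :=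
  match tau with
  | Finite t =>
      lam_eff lam t * Rew - C * (lam_eff lam t / (mu * (1 - sigma lam mu t)))
  | _ => 0
  end.

(** [m] is the maximum, attained, of [u] over the [x] satisfying [P]. *)
Definition is_max {A : Type} (P : A -> Prop) (u : A -> R) (m : R) : Prop :=
  (exists x, P x /\ u x = m) /\ (forall x, P x -> u x <= m).

(* Main.v *)
(** Put x = mu (1 - sigma), the rate of the exponential sojourn time under gated
    admission.  The fixed-point equation can be solved for tau:
      tau = T(x) := - (ln (1 + x/lam) + ln (1 - x/mu)) / x,   0 < x < mu,
    and T is strictly increasing by strict concavity of ln.  The gated welfare
    thus becomes the explicit continuous function lam/(1 + lam T(x)) (Rew - C/x);
    it is nonpositive for x <= C/Rew and small for large T(x), so its supremum is
    attained on a compact interval unless it is at most 0 = u(pi_oo).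

    For the comparison, take tau with lam_tau = q = lam p.  Since ln (1 + y) - y
    decreases on y >= 0 and q <= lam, T(mu - q) <= tau, so mu (1 - sigma(tau)) >=
    mu - q: at equal throughput the gated queue has the smaller sojourn time. *)

Require Import Defs.
From Stdlib Require Import Reals Lra Classical ClassicalEpsilon.
From Coquelicot Require Import Coquelicot.

Open Scope R_scope.

(** * Attained maxima on a compact parameter interval *)

Lemma ex_derive_continuity_pt (f : R -> R) (x : R) :
  ex_derive f x -> continuity_pt f x.
Proof.
  intros H. apply continuity_pt_filterlim. exact (ex_derive_continuous f x H).
Qed.

(** Extreme value theorem for a domain that need not be compact: [x0] dominates whatever the
    interval does not cover, and the larger of [u x0] and the maximum of [v] wins. For [b < a] only
    [x0] competes. *)
Lemma is_max_of_parametrization {A : Type} (P : A -> Prop) (u : A -> R)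
    (g : R -> A) (v : R -> R) (a b : R) (x0 : A) :
  P x0 ->
  (forall y, a <= y <= b -> P (g y) /\ u (g y) = v y /\ continuity_pt v y) ->
  (forall x, P x -> u x <= u x0 \/ exists y, a <= y <= b /\ u x <= v y) ->
  exists m, is_max P u m.
Proof.
  intros P0 Hg Hcov.
  destruct (Rle_or_lt a b) as [Hab | Hab].
  - destruct (continuity_ab_maj v a b Hab) as [M [HM HMab]].
    { intros y Hy. apply Hg, Hy. }
    destruct (Hg M HMab) as [PM [uM _]].
    destruct (Rle_or_lt (u x0) (v M)) as [H0 | H0].
    + exists (v M). split.
      * exists (g M). now split.
      * intros x Px. destruct (Hcov x Px) as [H | [y [Hy H]]]; [lra |].
        specialize (HM y Hy). lra.
    + exists (u x0). split.
      * exists x0. now split.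
      * intros x Px. destruct (Hcov x Px) as [H | [y [Hy H]]]; [lra |].
        specialize (HM y Hy). lra.
  - exists (u x0). split.
    + exists x0. now split.
    + intros x Px. destruct (Hcov x Px) as [H | [y [Hy _]]]; [exact H | lra].
Qed.

(** * Concavity inequalities for the logarithm *)

Lemma ln_lt_sub_1 (u : R) : 0 < u -> u <> 1 -> ln u < u - 1.
Proof.
  intros Hu Hu1.
  assert (Hl : ln u <> 0).
  { intros H. apply Hu1. rewrite <- (exp_ln u Hu), H. apply exp_0. }
  pose proof (exp_ineq1 (ln u) Hl) as H. rewrite exp_ln in H; lra.
Qed.

Lemma ln_lt_tangent (a u : R) :
  0 < a -> 0 < u -> u <> a -> ln u < ln a + (u - a) / a.
Proof.
  intros Ha Hu Hne.
  assert (Hq : 0 < u / a) by now apply Rdiv_lt_0_compat.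
  assert (Hq1 : u / a <> 1).
  { intros H. apply Hne. replace u with (u / a * a) by (field; lra).
    rewrite H. ring. }
  pose proof (ln_lt_sub_1 _ Hq Hq1) as H.
  rewrite ln_div in H by assumption.
  replace ((u - a) / a) with (u / a - 1) by (field; lra). lra.
Qed.

(** The chord slope [ln (1 + c x) / x] decreases by strict concavity, here cross-multiplied. The
    tangent at [1 + c x] is evaluated at [1] and at [1 + c y]. Either sign of [c] occurs below:
    [/ lam] and [- / mu]. *)
Lemma ln_1_plus_slope_decreasing (c x y : R) :
  c <> 0 -> 0 < x -> x < y -> 0 < 1 + c * x -> 0 < 1 + c * y ->
  x * ln (1 + c * y) < y * ln (1 + c * x).
Proof.
  intros Hc Hx Hxy Ha Hy.
  assert (N1 : 1 + c * y <> 1 + c * x).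
  { intros H. assert (E : c * (y - x) = 0) by lra.
    apply Rmult_integral in E. lra. }
  assert (N2 : 1 <> 1 + c * x).
  { intros H. assert (E : c * x = 0) by lra.
    apply Rmult_integral in E. lra. }
  pose proof (ln_lt_tangent _ _ Ha Hy N1) as H1.
  pose proof (ln_lt_tangent _ _ Ha Rlt_0_1 N2) as H2.
  rewrite ln_1 in H2.
  apply (Rmult_lt_compat_l x) in H1; [| lra].
  apply (Rmult_lt_compat_l (y - x)) in H2; [| lra].
  (* The tangent terms cancel because 1 + c x is the mean of 1 and 1 + c y with
     weights (y - x) : x. *)
  assert (E : x * ((1 + c * y - (1 + c * x)) / (1 + c * x))
              + (y - x) * ((1 - (1 + c * x)) / (1 + c * x)) = 0)
    by (field; lra).
  lra.
Qed.

(** The tangent of [ln] at [1 + y] has slope [1 / (1 + y)], at most 1. *)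
Lemma ln_1_plus_sub_antitone (y z : R) :
  0 <= y -> y <= z -> ln (1 + z) - z <= ln (1 + y) - y.
Proof.
  intros Hy [Hyz | ->]; [| lra].
  pose proof (ln_lt_tangent (1 + y) (1 + z)) as H.
  assert (Hd : (1 + z - (1 + y)) / (1 + y) <= z - y).
  { apply Rle_div_l; [lra |]. pose proof (Rmult_le_pos y (z - y)). lra. }
  lra.
Qed.

(** * The blocking time T(x) as a function of the sojourn rate x *)

Definition blocking_time (lam mu x : R) : R :=
  - (ln (1 + x / lam) + ln (1 - x / mu)) / x.

Lemma blocking_time_args (lam mu x : R) :
  0 < lam -> 0 < x < mu -> 0 < 1 + x / lam /\ 0 < 1 - x / mu.
Proof.
  intros Hl Hx. split.
  - assert (0 < x / lam) by (apply Rdiv_lt_0_compat; lra). lra.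
  - assert (x / mu < 1) by (apply Rlt_div_l; lra). lra.
Qed.

(** T is minus the sum of two chord slopes, with [c = / lam] and [c = - / mu], and both decrease. *)
Lemma blocking_time_lt (lam mu x y : R) :
  0 < lam -> 0 < x -> x < y -> y < mu ->
  blocking_time lam mu x < blocking_time lam mu y.
Proof.
  intros Hl Hx Hxy Hy.
  destruct (blocking_time_args lam mu x) as [A1 A2]; [lra .. |].
  destruct (blocking_time_args lam mu y) as [B1 B2]; [lra .. |].
  assert (Il : 0 < / lam) by (apply Rinv_0_lt_compat; lra).
  assert (Im : 0 < / mu) by (apply Rinv_0_lt_compat; lra).
  unfold blocking_time, Rdiv in *.
  replace (x * / lam) with (/ lam * x) in * by ring.
  replace (y * / lam) with (/ lam * y) in * by ring.
  replace (1 - x * / mu) with (1 + (- / mu) * x) in * by ring.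
  replace (1 - y * / mu) with (1 + (- / mu) * y) in * by ring.
  pose proof (ln_1_plus_slope_decreasing (/ lam) x y) as H1.
  pose proof (ln_1_plus_slope_decreasing (- / mu) x y) as H2.
  set (p := ln (1 + / lam * x)) in *. set (q := ln (1 + - / mu * x)) in *.
  set (r := ln (1 + / lam * y)) in *. set (s := ln (1 + - / mu * y)) in *.
  apply Rmult_lt_reg_r with (x * y); [apply Rmult_lt_0_compat; lra |].
  replace (- (p + q) * / x * (x * y)) with (- (y * p + y * q)) by (field; lra).
  replace (- (r + s) * / y * (x * y)) with (- (x * r + x * s)) by (field; lra).
  specialize (H1 ltac:(lra) Hx Hxy A1 B1).
  specialize (H2 ltac:(lra) Hx Hxy A2 B2). lra.
Qed.

Lemma blocking_time_le_inv (lam mu x y : R) :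
  0 < lam -> 0 < x < mu -> 0 < y < mu ->
  blocking_time lam mu x <= blocking_time lam mu y -> x <= y.
Proof.
  intros Hl Hx Hy H. destruct (Rle_or_lt x y) as [| Hlt]; [assumption |].
  pose proof (blocking_time_lt lam mu y x). lra.
Qed.

(** The ungated M/M/1 queue has sojourn rate [mu - lam]; there the two logarithms have reciprocal
    arguments. *)
Lemma blocking_time_root (lam mu : R) :
  0 < lam < mu -> blocking_time lam mu (mu - lam) = 0.
Proof.
  intros H. unfold blocking_time.
  destruct (blocking_time_args lam mu (mu - lam)) as [A1 A2]; [lra .. |].
  rewrite <- ln_mult by assumption.
  replace ((1 + (mu - lam) / lam) * (1 - (mu - lam) / mu)) with 1
    by (field; lra).
  rewrite ln_1. field. lra.
Qed.

(** Apply [ln u < u - 1] to both logarithms. The bound is exactly the stability threshold: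
    [lam_eff lam t < mu] means [t > / mu - / lam]. *)
Lemma blocking_time_gt (lam mu x : R) :
  0 < lam -> 0 < x < mu -> / mu - / lam < blocking_time lam mu x.
Proof.
  intros Hl Hx.
  destruct (blocking_time_args lam mu x) as [A1 A2]; [lra .. |].
  assert (0 < x / lam) by (apply Rdiv_lt_0_compat; lra).
  assert (0 < x / mu) by (apply Rdiv_lt_0_compat; lra).
  pose proof (ln_lt_sub_1 _ A1). pose proof (ln_lt_sub_1 _ A2).
  unfold blocking_time.
  apply Rlt_div_r; [lra |].
  replace ((/ mu - / lam) * x) with (x / mu - x / lam) by (field; lra). lra.
Qed.

(** For [lam < mu], T increases from its zero at [mu - lam]; otherwise the stability threshold is
    already nonnegative. *)
Lemma blocking_time_nonneg (lam mu x : R) :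
  0 < lam -> 0 < x < mu -> mu - lam <= x -> 0 <= blocking_time lam mu x.
Proof.
  intros Hl Hx Hle.
  destruct (Rlt_or_le lam mu) as [Hlm | Hlm].
  - destruct Hle as [Hlt | <-].
    + rewrite <- (blocking_time_root lam mu) by lra.
      apply Rlt_le, blocking_time_lt; lra.
    + rewrite blocking_time_root; lra.
  - pose proof (blocking_time_gt lam mu x Hl Hx).
    pose proof (Rinv_le_contravar mu lam). lra.
Qed.

(** * Stability and the fixed-point equation in terms of x *)

Lemma lam_eff_lt_iff (lam mu t : R) :
  0 < lam -> 0 < mu -> 0 <= t ->
  lam_eff lam t < mu <-> lam < mu * (1 + lam * t).
Proof.
  intros Hl Hm Ht. simpl. pose proof (Rmult_le_pos lam t).
  rewrite Rlt_div_l by lra. reflexivity.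
Qed.

Lemma blocking_time_admissible (lam mu x : R) :
  0 < lam -> 0 < x < mu -> mu - lam <= x ->
  GA_admissible lam mu (blocking_time lam mu x).
Proof.
  intros Hl Hx Hle. pose proof (blocking_time_nonneg lam mu x Hl Hx Hle) as Ht.
  split; [exact Ht |].
  apply lam_eff_lt_iff; [lra .. |].
  pose proof (blocking_time_gt lam mu x Hl Hx) as H.
  apply (Rmult_lt_compat_l (lam * mu)) in H; [| apply Rmult_lt_0_compat; lra].
  replace (lam * mu * (/ mu - / lam)) with (lam - mu) in H by (field; lra). lra.
Qed.

(** Under [s = 1 - x / mu] the equation becomes [w = exp (- (x t))] with
    [w = (1 + x / lam) (1 - x / mu)]; taking logarithms gives T. *)
Lemma sigma_equation_iff (lam mu t x : R) :
  0 < lam -> 0 < x < mu ->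
  sigma_equation lam mu t (1 - x / mu) <-> blocking_time lam mu x = t.
Proof.
  intros Hl Hx. unfold sigma_equation, blocking_time.
  destruct (blocking_time_args lam mu x) as [A1 A2]; [lra .. |].
  replace (mu * (1 - (1 - x / mu))) with x by (field; lra).
  rewrite <- ln_mult by assumption.
  set (w := (1 + x / lam) * (1 - x / mu)).
  assert (Hw : 0 < w) by now apply Rmult_lt_0_compat.
  assert (Ew : 1 - x / mu = lam * w / (lam + x)) by (unfold w; field; lra).
  rewrite Ew. split.
  - intros E.
    assert (E' : w = exp (- (x * t))).
    { apply Rmult_eq_reg_l with (lam / (lam + x)).
      - unfold Rdiv in *. lra.
      - apply Rgt_not_eq, Rdiv_lt_0_compat; lra. }
    rewrite E', ln_exp. field. lra.
  - intros <-. replace (- (x * (- ln w / x))) with (ln w) by (field; lra).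
    now rewrite exp_ln.
Qed.

(** T is injective, so [1 - x / mu] is the only root in (0,1), hence the smallest positive one, and
    [epsilon] must return it. *)
Lemma sigma_blocking_time (lam mu x : R) :
  0 < lam -> 0 < x < mu ->
  mu * (1 - Defs.sigma lam mu (blocking_time lam mu x)) = x.
Proof.
  intros Hl Hx. set (t := blocking_time lam mu x).
  destruct (blocking_time_args lam mu x) as [_ A2]; [lra .. |].
  assert (0 < x / mu) by (apply Rdiv_lt_0_compat; lra).
  assert (Hs : is_sigma lam mu t (1 - x / mu)).
  { split; [lra |]. split; [now apply sigma_equation_iff |].
    intros s' Hs' E. destruct (Rlt_or_le s' 1) as [H1 | H1]; [| lra].
    assert (Hx' : 0 < mu * (1 - s') < mu).
    { split; [apply Rmult_lt_0_compat; lra |].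
      pose proof (Rmult_lt_0_compat mu s'). lra. }
    replace s' with (1 - mu * (1 - s') / mu) in E |- * by (field; lra).
    apply sigma_equation_iff in E; [| lra | exact Hx'].
    assert (Hle : mu * (1 - s') <= x)
      by (apply (blocking_time_le_inv lam mu); unfold t in E; lra).
    assert (mu * (1 - s') / mu <= x / mu); [| lra].
    apply Rmult_le_compat_r; [| exact Hle].
    apply Rlt_le, Rinv_0_lt_compat; lra. }
  assert (Hsig : is_sigma lam mu t (Defs.sigma lam mu t)).
  { unfold Defs.sigma. apply epsilon_spec. now exists (1 - x / mu). }
  destruct Hs as [S1 [S2 S3]]. destruct Hsig as [T1 [T2 T3]].
  assert (E : Defs.sigma lam mu t = 1 - x / mu).
  { apply Rle_antisym; [apply T3 | apply S3]; assumption || lra. }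
  rewrite E. field. lra.
Qed.

(** Intermediate value theorem for [phi], the fixed-point equation with its denominator cleared. The
    trivial root [s = 1] makes [phi] vanish at 0, so the search starts at a positive [a] with
    [phi a < 0]. *)
Lemma blocking_time_surjective (lam mu t : R) :
  0 < lam -> 0 < mu -> 0 <= t -> lam < mu * (1 + lam * t) ->
  exists x, 0 < x < mu /\ blocking_time lam mu x = t.
Proof.
  intros Hl Hm Ht Hadm.
  assert (Hlt : 0 <= lam * t) by (apply Rmult_le_pos; lra).
  set (phi := fun x => lam * exp (- (x * t)) - (1 - x / mu) * (lam + x)).
  (* Half the stability gap: then [mu - lam / (1 + lam t) - a] is again [a], which fixes the sign of
     the factorization below. *)
  set (a := (mu - lam / (1 + lam * t)) / 2).
  assert (Heff : 0 < lam / (1 + lam * t) < mu).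
  { split; [apply Rdiv_lt_0_compat; lra | apply Rlt_div_l; lra]. }
  assert (Ha : 0 < a < mu) by (unfold a; lra).
  assert (Hcont : continuity phi).
  { intros x. apply ex_derive_continuity_pt. unfold phi. auto_derive; lra. }
  assert (Hat : 0 <= a * t) by (apply Rmult_le_pos; lra).
  assert (Hphia : phi a < 0).
  { unfold phi.
    (* This bound turns the sign of [phi a] into a rational inequality. *)
    assert (He : exp (- (a * t)) <= / (1 + a * t)).
    { rewrite exp_Ropp. apply Rinv_le_contravar; [lra | apply exp_ineq1_le]. }
    apply (Rmult_le_compat_l lam) in He; [| lra].
    assert (Hi : lam * / (1 + a * t) < (1 - a / mu) * (lam + a)); [| lra].
    apply Rlt_div_l; [lra |].
    assert (E : (1 - a / mu) * (lam + a) * (1 + a * t) - lam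
                = a * ((1 + lam * t) * (mu - lam / (1 + lam * t) - a) / mu
                       + a * t * (1 - a / mu))) by (field; lra).
    replace (mu - lam / (1 + lam * t) - a) with a in E by (unfold a; lra).
    assert (0 < (1 + lam * t) * a / mu).
    { apply Rdiv_lt_0_compat; [apply Rmult_lt_0_compat |]; lra. }
    assert (0 <= a * t * (1 - a / mu)).
    { apply Rmult_le_pos; [lra |]. destruct (blocking_time_args lam mu a); lra. }
    pose proof (Rmult_lt_0_compat a ((1 + lam * t) * a / mu
                       + a * t * (1 - a / mu))).
    lra. }
  assert (Hphim : 0 < phi mu).
  { unfold phi. replace (1 - mu / mu) with 0 by (field; lra).
    pose proof (exp_pos (- (mu * t))).
    pose proof (Rmult_lt_0_compat lam (exp (- (mu * t)))). lra. }
  destruct (IVT phi a mu Hcont) as [x [Hx E]]; [lra .. |].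
  assert (Hxm : x <> mu) by (intros ->; lra).
  assert (Hx' : 0 < x < mu) by lra.
  exists x. split; [exact Hx' |].
  apply sigma_equation_iff; [lra .. |]. unfold sigma_equation.
  replace (mu * (1 - (1 - x / mu))) with x by (field; lra).
  apply Rmult_eq_reg_r with (lam + x); [| lra].
  replace (lam * exp (- (x * t)) / (lam + x) * (lam + x))
    with (lam * exp (- (x * t))) by (field; lra).
  unfold phi in E. lra.
Qed.

(** * Gated welfare and its maximum *)

Definition gated_welfare (lam mu Rew C x : R) : R :=
  lam / (1 + lam * blocking_time lam mu x) * (Rew - C / x).

Lemma u_GA_blocking_time (lam mu Rew C x : R) :
  0 < lam -> 0 < x < mu ->
  u_GA lam mu Rew C (blocking_time lam mu x) = gated_welfare lam mu Rew C x.
Proof.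
  intros Hl Hx. unfold u_GA, gated_welfare.
  rewrite sigma_blocking_time by assumption. simpl. unfold Rdiv. ring.
Qed.

Lemma gated_welfare_continuous (lam mu Rew C x : R) :
  0 < lam -> 0 < x < mu -> 0 <= blocking_time lam mu x ->
  continuity_pt (gated_welfare lam mu Rew C) x.
Proof.
  intros Hl Hx Ht. apply ex_derive_continuity_pt.
  destruct (blocking_time_args lam mu x) as [A1 A2]; [lra .. |].
  pose proof (Rmult_le_pos lam _ (Rlt_le _ _ Hl) Ht) as H.
  unfold gated_welfare, blocking_time in *. auto_derive.
  unfold Rdiv, Rminus in *. repeat split; lra.
Qed.

Lemma GA_admissible_infty (lam mu : R) :
  0 < mu -> GA_admissible lam mu p_infty.
Proof. intros Hm. split; [exact I | exact Hm]. Qed.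

(** Confines gates of positive welfare to a compact range: the throughput is below [1 / t] and the
    net reward [Rew - C / x] lies strictly between 0 and [Rew]. *)
Lemma u_GA_positive_bounds (lam mu Rew C t : R) :
  0 < lam -> 0 < mu -> 0 < Rew -> 0 < C -> GA_admissible lam mu (Finite t) ->
  0 < u_GA lam mu Rew C t ->
  t * u_GA lam mu Rew C t < Rew /\
  exists x, 0 < x < mu /\ C / Rew <= x /\ blocking_time lam mu x = t.
Proof.
  intros Hl Hm HR HC [Ht Hadm] Hu. simpl in Ht.
  apply lam_eff_lt_iff in Hadm; [| assumption ..].
  destruct (blocking_time_surjective lam mu t) as [x [Hx E]]; [assumption .. |].
  assert (Eu : u_GA lam mu Rew C t = lam / (1 + lam * t) * (Rew - C / x)).
  { rewrite <- E, u_GA_blocking_time by assumption. reflexivity. }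
  rewrite Eu in *.
  assert (Hlt : 0 <= lam * t) by (apply Rmult_le_pos; lra).
  assert (Hq : 0 < lam / (1 + lam * t)) by (apply Rdiv_lt_0_compat; lra).
  assert (HCx : 0 < C / x) by (apply Rdiv_lt_0_compat; lra).
  assert (Hpos : 0 < Rew - C / x).
  { apply Rmult_lt_reg_l with (lam / (1 + lam * t)); lra. }
  split.
  - assert (Htq : 0 <= t * (lam / (1 + lam * t)) < 1).
    { split; [apply Rmult_le_pos; lra |].
      unfold Rdiv. rewrite <- Rmult_assoc. apply Rlt_div_l; lra. }
    rewrite <- Rmult_assoc.
    apply Rle_lt_trans with (1 * (Rew - C / x)); [| lra].
    apply Rmult_le_compat_r; lra.
  - exists x. split; [exact Hx |]. split; [| exact E].
    assert (Hlt' : C < Rew * x) by (apply Rlt_div_l; lra).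
    apply Rle_div_l; lra.
Qed.

Lemma u_GA_has_max (lam mu Rew C : R) :
  0 < lam -> 0 < mu -> 0 < Rew -> 0 < C ->
  exists m, is_max (GA_admissible lam mu) (u_GA lam mu Rew C) m.
Proof.
  intros Hl Hm HR HC.
  destruct (classic (exists t : R, GA_admissible lam mu (Finite t) /\
                                   0 < u_GA lam mu Rew C (Finite t)))
    as [[t0 [Hadm0 Hu0]] | Hno].
  (* If no finite gate has positive welfare, never admitting is optimal. *)
  2:{ exists 0. split.
      - exists p_infty. split; [now apply GA_admissible_infty | reflexivity].
      - intros [t | |] Hadm; [| simpl; lra ..].
        apply Rnot_lt_le. intros H. apply Hno. now exists t. }
  destruct (u_GA_positive_bounds lam mu Rew C t0) as [Hthr0 _]; [assumption .. |].
  set (e := u_GA lam mu Rew C t0) in *.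
  (* Beyond t1 the reward rate alone is below the value e already achieved. *)
  set (t1 := Rew / e).
  assert (Ht01 : t0 <= t1) by (apply Rle_div_r; lra).
  destruct Hadm0 as [Ht0 Hlt0]. simpl in Ht0.
  destruct (blocking_time_surjective lam mu t1) as [x1 [Hx1 E1]]; [lra .. | |].
  { apply lam_eff_lt_iff in Hlt0; [| assumption ..].
    eapply Rlt_le_trans; [exact Hlt0 |].
    apply Rmult_le_compat_l; [lra |].
    pose proof (Rmult_le_compat_l lam t0 t1). lra. }
  assert (Hb : 0 < C / Rew) by now apply Rdiv_lt_0_compat.
  (* The lower end keeps [y] positive and T(y) nonnegative; the upper end [x1] has T([x1]) =
     [t1]. *)
  apply (is_max_of_parametrization _ _
           (fun x => Finite (blocking_time lam mu x))
           (gated_welfare lam mu Rew C) (Rmax (C / Rew) (mu - lam)) x1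
           (Finite t0)).
  - now split.
  - intros y [Hy1 Hy2].
    pose proof (Rmax_l (C / Rew) (mu - lam)).
    pose proof (Rmax_r (C / Rew) (mu - lam)).
    assert (Hy : 0 < y < mu) by lra.
    split; [apply blocking_time_admissible; lra |].
    split; [now apply u_GA_blocking_time |].
    apply gated_welfare_continuous; [lra .. |].
    apply blocking_time_nonneg; lra.
  - intros [t | |] Hadm; [| left; change (0 <= e); lra ..].
    destruct (Rle_or_lt (u_GA lam mu Rew C t) e) as [Hle | Hgt]; [now left |].
    right.
    destruct (u_GA_positive_bounds lam mu Rew C t) as [Hthr [x [Hx [Hxb E]]]];
      [assumption || lra .. |].
    exists x. split.
    + destruct Hadm as [Ht Hlt]. simpl in Ht. split.
      * apply Rmax_lub; [exact Hxb |].
        destruct (Rle_or_lt (mu - lam) x) as [| Hxlt]; [assumption |].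
        pose proof (blocking_time_lt lam mu x (mu - lam)).
        pose proof (blocking_time_root lam mu). lra.
      (* Welfare above [e] forces [t e <= Rew], that is [t <= t1]. *)
      * apply (blocking_time_le_inv lam mu); [assumption .. |].
        rewrite E, E1. apply Rle_div_r; [lra |].
        apply Rle_trans with (t * u_GA lam mu Rew C t); [| lra].
        apply Rmult_le_compat_l; lra.
    + rewrite <- E, u_GA_blocking_time by assumption. lra.
Qed.

(** * Maximum of the random routing welfare *)

(** The welfare is [lam p (Rew - C / (mu - lam p))], nonpositive once [lam p >= mu - C / Rew]. So
    [p = 0] dominates beyond [d], and [[0, min 1 d]], empty if [d < 0], stays away from the pole. *)
Lemma u_RR_has_max (lam mu Rew C : R) :
  0 < lam -> 0 < mu -> 0 < Rew -> 0 < C ->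
  exists m, is_max (RR_admissible lam mu) (u_RR lam mu Rew C) m.
Proof.
  intros Hl Hm HR HC.
  assert (H0 : u_RR lam mu Rew C 0 = 0) by (unfold u_RR; field; lra).
  assert (Hb : 0 < C / Rew) by now apply Rdiv_lt_0_compat.
  set (d := (mu - C / Rew) / lam).
  assert (Ed : lam * d = mu - C / Rew) by (unfold d; field; lra).
  apply (is_max_of_parametrization _ _ (fun p => p) (u_RR lam mu Rew C)
           0 (Rmin 1 d) 0).
  - split; lra.
  - intros p [Hp1 Hp2].
    pose proof (Rmin_l 1 d). pose proof (Rmin_r 1 d).
    pose proof (Rmult_le_compat_l lam p d).
    split; [split; lra |]. split; [reflexivity |].
    apply ex_derive_continuity_pt. unfold u_RR. auto_derive. lra.
  - intros p [[Hp0 Hp1] Hlp]. rewrite H0.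
    destruct (Rle_or_lt p d) as [Hpd | Hpd].
    + right. exists p. split; [| lra]. split; [lra | now apply Rmin_glb].
    + left. apply (Rmult_lt_compat_l lam) in Hpd; [| lra].
      unfold u_RR.
      replace (lam * p * Rew - C * (lam * p / (mu - lam * p)))
        with (lam * p * (Rew - C / (mu - lam * p))) by (field; lra).
      assert (Rew <= C / (mu - lam * p)).
      { apply Rle_div_r; [lra |].
        apply Rle_trans with (Rew * (C / Rew)).
        - apply Rmult_le_compat_l; lra.
        - right. field. lra. }
      pose proof (Rmult_le_pos (lam * p) (C / (mu - lam * p) - Rew)).
      pose proof (Rmult_le_pos lam p). lra.
Qed.

(** * Comparison at equal throughput *)

Lemma blocking_time_le_at_equal_throughput (lam mu q : R) :
  0 < q -> q <= lam -> q < mu ->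
  blocking_time lam mu (mu - q) <= / q - / lam.
Proof.
  intros Hq Hql Hqm. unfold blocking_time.
  apply Rle_div_l; [lra |].
  (* Both logarithms now have the form [ln (1 + y)], with [y = (mu - q) / lam] and
     [y = (mu - q) / q], and enter with opposite signs. *)
  replace (1 - (mu - q) / mu) with (/ (1 + (mu - q) / q)) by (field; lra).
  destruct (blocking_time_args q mu (mu - q)) as [A _]; [lra .. |].
  rewrite ln_Rinv by exact A.
  replace ((/ q - / lam) * (mu - q)) with ((mu - q) / q - (mu - q) / lam)
    by (field; lra).
  pose proof (ln_1_plus_sub_antitone ((mu - q) / lam) ((mu - q) / q)) as H.
  assert (0 <= (mu - q) / lam) by (apply Rlt_le, Rdiv_lt_0_compat; lra).
  assert ((mu - q) / lam <= (mu - q) / q).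
  { apply Rmult_le_compat_l; [lra |]. apply Rinv_le_contravar; lra. }
  lra.
Qed.

Lemma u_RR_le_u_GA (lam mu Rew C p : R) :
  0 < lam -> 0 < mu -> 0 < C -> RR_admissible lam mu p ->
  exists tau, GA_admissible lam mu tau /\
              u_RR lam mu Rew C p <= u_GA lam mu Rew C tau.
Proof.
  intros Hl Hm HC [[Hp0 Hp1] Hlp].
  destruct Hp0 as [Hp0 | <-].
  (* Zero throughput is matched by the infinite gate. *)
  2:{ exists p_infty. split; [now apply GA_admissible_infty |].
      unfold u_RR. simpl. right. field. lra. }
  set (q := lam * p) in *.
  assert (Hq : 0 < q) by now apply Rmult_lt_0_compat.
  assert (Hql : q <= lam)
    by (unfold q; pose proof (Rmult_le_compat_l lam p 1); lra).
  (* Solves [lam / (1 + lam t) = q]. *)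
  set (t := / q - / lam).
  assert (Ht : 0 <= t)
    by (unfold t; pose proof (Rinv_le_contravar q lam); lra).
  assert (Heff : lam / (1 + lam * t) = q) by (unfold t; field; lra).
  assert (Hadm : GA_admissible lam mu t).
  { split; [exact Ht |]. simpl. lra. }
  exists (Finite t). split; [exact Hadm |].
  destruct Hadm as [_ Hadm]. apply lam_eff_lt_iff in Hadm; [| assumption ..].
  destruct (blocking_time_surjective lam mu t) as [x [Hx E]]; [assumption .. |].
  assert (Hxq : mu - q <= x).
  { apply (blocking_time_le_inv lam mu); [lra .. |].
    rewrite E. now apply blocking_time_le_at_equal_throughput. }
  rewrite <- E, u_GA_blocking_time by assumption.
  unfold gated_welfare. rewrite E, Heff. unfold u_RR. fold q.
  replace (q * Rew - C * (q / (mu - q))) with (q * (Rew - C / (mu - q)))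
    by (field; lra).
  apply Rmult_le_compat_l; [lra |].
  assert (C / x <= C / (mu - q)); [| lra].
  apply Rmult_le_compat_l; [lra |]. apply Rinv_le_contravar; lra.
Qed.

Theorem corollary2 (lam mu Rew C : R)
  (hlam : 0 < lam) (hmu : 0 < mu) (hRew : 0 < Rew) (hC : 0 < C) :
  exists mRR mGA : R,
    is_max (RR_admissible lam mu) (u_RR lam mu Rew C) mRR /\
    is_max (GA_admissible lam mu) (u_GA lam mu Rew C) mGA /\
    mRR <= mGA.
Proof.
  destruct (u_RR_has_max lam mu Rew C) as [mRR HRR]; [assumption .. |].
  destruct (u_GA_has_max lam mu Rew C) as [mGA HGA]; [assumption .. |].
  exists mRR, mGA. split; [exact HRR |]. split; [exact HGA |].
  destruct HRR as [[p [Hp <-]] _]. destruct HGA as [_ HGA].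
  destruct (u_RR_le_u_GA lam mu Rew C p) as [tau [Htau Hle]]; [assumption .. |].
  eapply Rle_trans; [exact Hle | now apply HGA].
Qed.
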